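(* Let $\mathcal H=\{H_i\}_{i\in I}$ be a family of atomic monoids indexed by a non-empty set $I$, and let $\mathsf P_{\mathcal H}$ be the product of $\mathcal H$ in $\mathsf{AtoMon}$. Then $$\mathscr L(\mathsf P_{\mathcal H})=\left\{\bigcap_{i\in I}L_i: L_i\in\mathscr L(H_i)\text{ for every }i\in I\right\}\setminus\{\emptyset\}.$$
   Context: Monoids are not assumed commutative. For a monoid $H$, $H^\times$ is the group of units. An atom of $H$ is a non-unit $a\in H$ such that $a=xy$ with $x,y\in H$ implies $x\in H^\times$ or $y\in H^\times$; $\mathscr A(H)$ is the set of atoms. $H$ is atomic if every non-unit is a (non-empty, finite) product of atoms. $\mathsf{AtoMon}$ is the category whose objects are atomic monoids and whose morphisms are the monoid homomorphisms between atomic monoids sending atoms to atoms. The product $\mathsf P_{\mathcal H}$ in $\mathsf{AtoMon}$ is the submonoid of the direct product $\prod_{i\in I}H_i$ generated by all $f$ such that either $f(i)\in H_i^\times$ for every $i\in I$, or $f(i)\in\mathscr A(H_i)$ for every $i\in I$ (with the restricted projections). For $x\in H$, the length set $\mathsf L_H(x)\subseteq\mathbb N$ is the set of all $k\in\mathbb N$ such that $x=a_1\cdots a_k$ for some $a_1,\ldots,a_k\in\mathscr A(H)$ (the empty product, $k=0$, being $1_H$). Set $\mathscr L(H):=\{\mathsf L_H(x): x\in H\}\setminus\{\emptyset\}$. *)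

(* Defs.v *)
From HB Require Import structures.
From mathcomp Require Import all_boot all_classical.

Set Implicit Arguments.
Unset Strict Implicit.
Unset Printing Implicit Defensive.

Local Open Scope group_scope.
Local Open Scope classical_set_scope.

Section Monoids.
Variable H : monoidType.

Definition munits : set H := [set x | exists y, x * y = 1 /\ y * x = 1].

Definition atoms : set H :=
  [set a | ~ munits a /\ forall x y, a = x * y -> munits x \/ munits y].

Definition atomic : Prop :=
  forall x, ~ munits x ->
    exists s : seq H,
      [/\ s <> [::], [set` s] `<=` atoms & x = \prod_(a <- s) a].

(* Factorizations are ordered words of atoms (H need not be commutative).  The
   empty word is allowed, so 0 is a length of 1 and of no other element. *)
Definition length_set (x : H) : set nat :=
  [set k | exists s : seq H,
      [/\ size s = k, [set` s] `<=` atoms & x = \prod_(a <- s) a]].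

Definition length_system : set (set nat) := range length_set `\ set0.

Definition submonoid_generated (A : set H) : set H :=
  smallest [set S : set H | S 1 /\ forall x y, S x -> S y -> S (x * y)] A.

Lemma submonoid_generated_closed (A : set H) :
  monoid_closed (fun x => x \in submonoid_generated A).
Proof.
split=> [|x y]; rewrite !unfold_in; first by apply/mem_set => S [[]].
move=> /set_mem Ax /set_mem Ay; apply/mem_set => S CS; have [[_ SM] _] := CS.
by apply: SM; [exact: Ax CS|exact: Ay CS].
Qed.

End Monoids.

Section DirectProduct.
Variables (I : Type) (H : I -> monoidType).

Definition direct_product : Type := forall i, H i.

HB.instance Definition _ := Choice.copy direct_product (forall i, H i).

Implicit Types f g h : direct_product.

Definition dprod_one : direct_product := fun=> 1.
Definition dprod_mul f g : direct_product := fun i => f i * g i.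

Lemma dprod_mulA : associative dprod_mul.
Proof. by move=> f g h; apply: functional_extensionality_dep => i; exact: mulgA. Qed.

Lemma dprod_mul1 : left_id dprod_one dprod_mul.
Proof. by move=> f; apply: functional_extensionality_dep => i; exact: mul1g. Qed.

Lemma dprod_mulr1 : right_id dprod_one dprod_mul.
Proof. by move=> f; apply: functional_extensionality_dep => i; exact: mulg1. Qed.

HB.instance Definition _ :=
  isMonoid.Build direct_product dprod_mulA dprod_mul1 dprod_mulr1.

Definition atomon_generators : set direct_product :=
  [set f | (forall i, munits (f i)) \/ (forall i, atoms (f i))].

Definition in_atomon_product : pred direct_product :=
  fun f => f \in submonoid_generated atomon_generators.

(* Carrier of the product of the H i in the category AtoMon; the projections
   are the maps f |-> val f i. *)
Definition atomon_product : Type := {f : direct_product | in_atomon_product f}.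

HB.instance Definition _ := SubChoice.on atomon_product.
HB.instance Definition _ :=
  SubChoice_isSubMonoid.Build direct_product in_atomon_product atomon_product
    (submonoid_generated_closed atomon_generators).

End DirectProduct.

(* Main.v *)
Require Import Defs.
From mathcomp Require Import all_boot all_classical.
Local Open Scope classical_set_scope.

(** The theorem reduces to a pointwise formula for length sets in the product
    [P] of the [H i]: the length set of [f] in [P] is the intersection of the
    length sets of the coordinates [f i] ([length_set_product]).

    The formula rests on the identification of the atoms of [P] with the
    families of atoms ([atom_productE]).  The reason is a dichotomy: the
    generators of [P] are families of units and families of atoms, and a family
    of units times a family of atoms is again a family of atoms; so an element
    of [P] is either a family of units or splits off a family of atoms as its
    left factor ([product_unit_or_atom_factor]).  In the second case none of its
    coordinates is a unit, because an atom never has a right inverse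
    ([atom_mul_nonunit]).  Hence a family of atoms cannot be the product of two
    elements of the second kind, and an atom of [P] is a family of atoms times
    a family of units.

    Given this, a word of [k] atoms of [P] is the same thing as a word of [k]
    atoms in every [H i].  Reading such words column by column
    ([lift_factorizations]) also shows that any family whose coordinates share
    a common length lies in [P]; so a non-empty intersection of length sets
    [L i] of elements [x i] is the length set of the element [x] of [P]. *)

Lemma dependent_family_choice {I : Type} {T : I -> Type}
    {P : forall i, T i -> Prop} :
  (forall i, exists y, P i y) -> exists x : forall i, T i, forall i, P i (x i).
Proof.
by move=> exP; exists (fun i => projT1 (cid (exP i))) => i; apply: projT2.
Qed.

Section UnitsAndAtoms.
Set Implicit Arguments.
Unset Strict Implicit.
Local Open Scope group_scope.
Variable H : monoidType.
Implicit Types a u x y : H.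

Lemma munitsM x y : munits x -> munits y -> munits (x * y).
Proof.
move=> [x' [xx' x'x]] [y' [yy' y'y]]; exists (y' * x'); split.
  by rewrite -mulgA (mulgA y) yy' mul1g.
by rewrite -mulgA (mulgA x') x'x mul1g.
Qed.

Lemma munits_mulKl u x : munits u -> munits (u * x) -> munits x.
Proof.
move=> [v [uv vu]] ux; have -> : x = v * (u * x) by rewrite mulgA vu mul1g.
by apply: munitsM => //; exists u.
Qed.

Lemma munits_mulKr u x : munits u -> munits (x * u) -> munits x.
Proof.
move=> [v [uv vu]] xu; have -> : x = x * u * v by rewrite -mulgA uv mulg1.
by apply: munitsM => //; exists u.
Qed.

Lemma atom_mull u a : munits u -> atoms a -> atoms (u * a).
Proof.
move=> Uu [Na Aa]; split=> [/(munits_mulKl Uu)//|x y uaxy].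
have [v [uv vu]] := Uu.
have /Aa[Uvx|] : a = (v * x) * y by rewrite -mulgA -uaxy mulgA vu mul1g.
- by left; apply: munits_mulKl Uvx; exists u.
- by right.
Qed.

Lemma atom_mulr u a : munits u -> atoms a -> atoms (a * u).
Proof.
move=> Uu [Na Aa]; split=> [/(munits_mulKr Uu)//|x y auxy].
have [v [uv vu]] := Uu.
have /Aa[|Uyv] : a = x * (y * v) by rewrite mulgA -auxy -mulgA uv mulg1.
- by left.
- by right; apply: munits_mulKr Uyv; exists u.
Qed.

(** If [a * x] is a unit, then [a] has a right inverse [b], and
    [a = a * (b * a)] forces [b * a] to be a unit; being idempotent, it is
    then [1], which makes [a] itself a unit. *)
Lemma atom_mul_nonunit a x : atoms a -> ~ munits (a * x).
Proof.
move=> [Na Aa] [w [axw _]]; set b := x * w.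
have ab1 : a * b = 1 by rewrite mulgA.
have /Aa[//|[c [bac _]]] : a = a * (b * a) by rewrite mulgA ab1 mul1g.
apply: Na; exists b; split=> //.
have idem : b * a * (b * a) = b * a by rewrite -mulgA (mulgA a) ab1 mul1g.
by rewrite -[LHS]mulg1 -bac mulgA idem.
Qed.

End UnitsAndAtoms.

Section Product.
Set Implicit Arguments.
Unset Strict Implicit.
Local Open Scope group_scope.
Variables (I : Type) (H : I -> monoidType).
Implicit Types (f g : atomon_product H) (x : direct_product H).

Lemma atomon_product_gen x : atomon_generators x -> in_atomon_product x.
Proof. by move=> gx; apply/mem_set => S [_]; exact. Qed.

Lemma valM_at f g i : val (f * g) i = val f i * val g i.
Proof. by []. Qed.

Lemma val_prod_at (s : seq (atomon_product H)) i :
  val (\prod_(f <- s) f) i = \prod_(f <- s) val f i.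
Proof. by elim: s => [|f s IHs]; rewrite ?big_nil ?big_cons // valM_at IHs. Qed.

Lemma product_eqP f g : (forall i, val f i = val g i) -> f = g.
Proof. by move=> fg; apply: val_inj; apply: functional_extensionality_dep. Qed.

Lemma munits_at f i : munits f -> munits (val f i).
Proof. by move=> [g [fg gf]]; exists (val g i); rewrite -!valM_at fg gf. Qed.

(** The inverses of the coordinates form a family of units, so they are
    among the generators of the product. *)
Lemma product_munits f : (forall i, munits (val f i)) -> munits f.
Proof.
move=> Uf.
have [v fv] := dependent_family_choice Uf.
have vP : in_atomon_product (v : direct_product H).
  apply: atomon_product_gen; left=> i; have [fvi vfi] := fv i.
  by exists (val f i).
by exists (Sub v vP); split; apply: product_eqP => i;
   rewrite valM_at SubK; have [] := fv i.
Qed.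

(** The generators satisfy the alternative, and multiplication preserves it: in
    a product of two elements, either the left one already splits off a family
    of atoms, or it is a family of units, which is absorbed by the family of
    atoms that the right one splits off, if any. *)
Lemma product_unit_or_atom_factor f :
  (forall i, munits (val f i)) \/
  exists g h, f = g * h /\ forall i, atoms (val g i).
Proof.
(* The generated submonoid lives in the direct product, so the induction runs
   over elements of the direct product that lift to the product. *)
pose D x := exists2 f, val f = x & (forall i, munits (val f i)) \/
  exists g h, f = g * h /\ forall i, atoms (val g i).
suff [f' /val_inj-> //] : D (val f).
have := valP f; rewrite /in_atomon_product => /set_mem; apply: smallest_sub.
  split; first by exists 1 => //; left=> i; exists 1; rewrite mul1g.
  move=> _ _ [f1 <- Df1] [f2 <- Df2]; exists (f1 * f2) => //.
  case: Df1 => [Uf1|[g [h [-> Ag]]]]; last first.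
    by right; exists g, (h * f2); rewrite mulgA.
  case: Df2 => [Uf2|[g [h [-> Ag]]]].
    by left=> i; apply: munitsM.
  right; exists (f1 * g), h; rewrite mulgA; split=> // i.
  exact: atom_mull.
move=> x gx; exists (Sub x (atomon_product_gen gx)) => //.
case: gx => [Ux|Ax]; first by left.
by right; exists (Sub x (atomon_product_gen (or_intror Ax))), 1;
   split=> //; rewrite mulg1; apply: product_eqP.
Qed.

(** A coordinate [i0] is needed to tell units from families of atoms: over an
    empty index set the only element of the product is both a unit and,
    vacuously, a family of atoms. *)
Lemma atom_productE (I_nonempty : inhabited I) f :
  atoms f <-> forall i, atoms (val f i).
Proof.
have [i0] := I_nonempty; split=> [[Nf Af] i|Af].
  have [/product_munits//|[g [h [fgh Ag]]]] := product_unit_or_atom_factor f.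
  have [/(munits_at i0)|/(munits_at i) Uh] := Af _ _ fgh; first by case: (Ag i0).
  by rewrite fgh valM_at; apply: atom_mulr.
split=> [/(munits_at i0)|x y fxy]; first by case: (Af i0).
have [/product_munits|[g [h [xgh Ag]]]] := product_unit_or_atom_factor x.
  by left.
have [/product_munits|[g' [h' [ygh Ag']]]] := product_unit_or_atom_factor y.
  by right.
have [_ /(_ (val x i0) (val y i0))[||]] := Af i0; first by rewrite fxy.
- by rewrite xgh valM_at => /(atom_mul_nonunit (Ag i0)).
- by rewrite ygh valM_at => /(atom_mul_nonunit (Ag' i0)).
Qed.

(** Words of the same size [k], one for each coordinate, are read column by
    column: their [j]-th letters form a family of atoms, hence an atom of the
    product.  Stating this for a family [x] of the direct product makes it also
    a membership criterion, which the theorem needs when it starts from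
    arbitrary length sets. *)
Lemma lift_factorizations (I_nonempty : inhabited I) k x :
  (forall i, length_set (x i) k) ->
  exists2 f : atomon_product H, val f = x & length_set f k.
Proof.
move=> xk.
have [w xw] := dependent_family_choice xk.
pose letter (j : 'I_k) : direct_product H := fun i => nth 1 (w i) j.
have letterA j i : atoms (letter j i).
  by have [sz A _] := xw i; apply: A; apply: mem_nth; rewrite sz.
have letterP j : in_atomon_product (letter j).
  by apply: atomon_product_gen; right.
pose s := [seq (Sub (letter j) (letterP j) : atomon_product H) | j <- enum 'I_k].
exists (\prod_(f <- s) f); last first.
  exists s; split=> //; first by rewrite size_map size_enum_ord.
  by move=> _ /mapP[j _ ->]; apply/(atom_productE I_nonempty) => i; exact: letterA.
apply: functional_extensionality_dep => i; rewrite val_prod_at big_map.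
have [sz _ ->] := xw i.
(* Both products are taken in word order: the monoids need not commute. *)
rewrite -(big_map val predT (fun j => nth 1 (w i) j)) val_enum_ord (big_nth 1).
by rewrite sz /index_iota subn0.
Qed.

Lemma length_set_product (I_nonempty : inhabited I) f :
  length_set f = \bigcap_(i : I) length_set (val f i).
Proof.
apply/seteqP; split=> k.
  move=> [s [sz A ->]] i _; exists [seq val g i | g <- s]; split.
  - by rewrite size_map.
  - by move=> _ /mapP[g gs ->]; move: i; apply/(atom_productE I_nonempty)/A.
  - by rewrite val_prod_at big_map.
move=> fk; have fik i : length_set (val f i) k by apply: fk.
by have [g /val_inj->] := lift_factorizations I_nonempty fik.
Qed.

End Product.

Theorem theorem5p7 (I : Type) (H : I -> monoidType)
    (I_nonempty : inhabited I)
    (H_atomic : forall i : I, atomic (H i)) :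
  length_system (atomon_product H) =
  [set \bigcap_(i : I) L i |
     L in [set L : I -> set nat | forall i : I, length_system (H i) (L i)]]
  `\ set0.
Proof.
apply/seteqP; split=> L.
  move=> [[f _ <-] /eqP/set0P[k fk]].
  split; last by apply/eqP/set0P; exists k.
  exists (fun i => length_set (val f i)); last by rewrite length_set_product.
  move=> i; split; first by exists (val f i).
  move: fk; rewrite length_set_product // => fk.
  by apply/eqP/set0P; exists k; apply: fk.
move=> [[M LM <-] N0]; split=> //.
have Mx i : exists y : H i, length_set y = M i.
  by have [[y _ yM] _] := LM i; exists y.
have [x xM] := dependent_family_choice Mx.
move/eqP/set0P: N0 => [k Mk].
have xk i : length_set (x i) k by rewrite xM; apply: Mk.
have [f fx _] := lift_factorizations I_nonempty xk.
exists f => //; rewrite length_set_product // fx.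
by apply: eq_bigcapr => i _; rewrite xM.
Qed.
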